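(* Let $H$ be a separable complex Hilbert space, $A\in\mathcal{B}(H)^+$, $T\in\mathcal{B}(H)$, and let $m,n$ be nonnegative integers. Then the following hold. (1) $T$ is $(A;(m,n))$-isosymmetric if and only if for each positive integer $k$ and every $s\in\mathbb{R}$, $$\big(e^{isT}\big)^{*k}\,\mathcal{I}^m_A(T)\,\big(e^{isT}\big)^k=\sum_{h=0}^{n-1}\frac{(-isk)^h}{h!}\,\Omega_A^{m,h}(T).$$ (2) $T$ is skew $(A;(m,n))$-isosymmetric if and only if for each positive integer $k$ and every $s\in\mathbb{R}$, $$\big(e^{isT^*}\big)^{k}\,\mathcal{I}^m_A(T)\,\big(e^{isT}\big)^k=\sum_{h=0}^{n-1}\frac{(isk)^h}{h!}\,\Lambda_A^{m,h}(T).$$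
   Context: $\mathcal{B}(H)$ is the algebra of bounded linear operators on $H$ and $\mathcal{B}(H)^+$ the set of positive (semi-definite) operators. For $A,T\in\mathcal{B}(H)$ and nonnegative integers $m,n$ put $$\mathcal{I}^m_A(T)=\sum_{k=0}^m(-1)^{m-k}\binom mk T^{*k}AT^k,\qquad \Omega_A^{m,n}(T)=\sum_{k=0}^n(-1)^{n-k}\binom nk T^{*k}\mathcal{I}^m_A(T)T^{n-k},\qquad \Lambda_A^{m,n}(T)=\sum_{k=0}^n\binom nk T^{*k}\mathcal{I}^m_A(T)T^{n-k}.$$ $T$ is $(A;(m,n))$-isosymmetric if $\Omega_A^{m,n}(T)=0$, and skew $(A;(m,n))$-isosymmetric if $\Lambda_A^{m,n}(T)=0$. *)

(* Defs.v *)
From HB Require Import structures.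
From mathcomp Require Import all_boot all_order all_algebra.
From mathcomp Require Export complex.
From mathcomp Require Import sesquilinear.
From mathcomp Require Import all_classical all_reals all_analysis.

Set Implicit Arguments.
Unset Strict Implicit.
Unset Printing Implicit Defensive.

Import Order.TTheory GRing.Theory Num.Theory.
Import numFieldNormedType.Exports.

Local Open Scope classical_set_scope.
Local Open Scope complex_scope.
Local Open Scope ring_scope.

(* The inner product is linear in its first argument. *)
HB.mixin Record NormedModule_hasDot (R : realType) H
    & NormedModule R[i] H := {
  dot : {dot H for (@Num.conj R[i])} ;
  normr_dotE : forall x : H, `|x| ^+ 2 = dot x x
}.

#[short(type="hilbertType")]
HB.structure Definition Hilbert (R : realType) :=
  {H of CompleteNormedModule R[i] H & NormedModule_hasDot R H}.

Definition separable (T : topologicalType) :=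
  exists D : set T, countable D /\ dense D.

Section BoundedOperators.
Context {R : realType} {H : hilbertType R}.

Definition bounded_operator : {pred H -> H} :=
  [pred f | `[< linear f /\ exists M : R[i], forall x, `|f x| <= M * `|x| >]].

Record bop := Bop { bop_val :> H -> H ; _ : bop_val \in bounded_operator }.

HB.instance Definition _ := [isSub for bop_val].
HB.instance Definition _ := [Choice of bop by <:].

Lemma boundedP (f : H -> H) :
  reflect (linear f /\ exists2 M : R[i], 0 <= M & forall x, `|f x| <= M * `|x|)
          (f \in bounded_operator).
Proof.
rewrite unfold_in; apply: (iffP (asboolP _)) => -[lf].
  move=> [M fM]; split=> //.
  have [M0|/negP M0] := boolP (0 <= M); first by exists M.
  exists 0 => // x; rewrite mul0r; apply: contra_notT M0 => fx0.
  have x0 : 0 < `|x|.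
    rewrite normr_gt0; apply: contraNneq fx0 => ->.
    by have := lf (-1) 0 0; rewrite !scaleN1r oppr0 addr0 addNr => ->; rewrite normr0.
  by rewrite -(pmulr_lge0 M x0); apply: le_trans (fM x).
by move=> [M _ fM]; split=> //; exists M.
Qed.

Lemma bounded_submod_closed : submod_closed bounded_operator.
Proof.
split.
  apply/boundedP; split; first by move=> a x y; rewrite scaler0 addr0.
  by exists 0 => // x; rewrite normr0 mul0r.
move=> a f g /boundedP[lf [M M0 fM]] /boundedP[lg [N N0 gN]].
apply/boundedP; split.
  move=> b x y /=; rewrite !fctE lf lg !scalerDr !scalerA (mulrC a b) !addrA.
  by congr (_ + _); rewrite addrAC.
exists (`|a| * M + N); first by rewrite addr_ge0// mulr_ge0.
move=> x; rewrite (le_trans (ler_normD _ _))// mulrDl lerD//.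
by rewrite normrZ -mulrA ler_wpM2l.
Qed.

HB.instance Definition _ :=
  GRing.isSubmodClosed.Build R[i] (H -> H) bounded_operator bounded_submod_closed.
HB.instance Definition _ := [SubChoice_isSubLmodule of bop by <:].

Lemma bop_linear (T : bop) : linear T.
Proof. by case: T => f /= /boundedP[]. Qed.

HB.instance Definition _ (T : bop) :=
  GRing.isLinear.Build R[i] H H *:%R (bop_val T) (bop_linear T).

Lemma bop_bounded (T : bop) :
  exists2 M : R[i], 0 <= M & forall x, `|T x| <= M * `|x|.
Proof. by case: T => f /= /boundedP[]. Qed.

Lemma bopP (S T : bop) : S =1 T -> S = T.
Proof. by move=> ST; apply/val_inj/funext. Qed.

Lemma bopD (S T : bop) x : (S + T) x = S x + T x. Proof. by []. Qed.
Lemma bopZ a (T : bop) x : (a *: T) x = a *: T x. Proof. by []. Qed.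

Fact bop_id_subproof : @id H \in bounded_operator.
Proof.
by apply/boundedP; split=> //; exists 1 => // x; rewrite mul1r.
Qed.
Definition bop_id : bop := Bop bop_id_subproof.

Fact bop_comp_subproof (S T : bop) : S \o T \in bounded_operator.
Proof.
have [M M0 SM] := bop_bounded S; have [N N0 TN] := bop_bounded T.
apply/boundedP; split; first by move=> a x y /=; rewrite !linearP.
exists (M * N); first exact: mulr_ge0.
by move=> x /=; rewrite (le_trans (SM _))// -mulrA ler_wpM2l.
Qed.
Definition bop_comp (S T : bop) : bop := Bop (bop_comp_subproof S T).

Fact bop_compA : associative bop_comp. Proof. by move=> S T U; exact: bopP. Qed.
Fact bop_comp1l : left_id bop_id bop_comp. Proof. by move=> S; exact: bopP. Qed.
Fact bop_comp1r : right_id bop_id bop_comp. Proof. by move=> S; exact: bopP. Qed.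
Fact bop_compDl : left_distributive bop_comp +%R.
Proof. by move=> S T U; exact: bopP. Qed.
Fact bop_compDr : right_distributive bop_comp +%R.
Proof. by move=> S T U; apply: bopP => x /=; rewrite linearD. Qed.

(* [S * T] is the composite [S \o T].  Only a [pzRingType], as [H] may be
   trivial. *)
HB.instance Definition _ := GRing.Zmodule_isPzRing.Build bop
  bop_compA bop_comp1l bop_comp1r bop_compDl bop_compDr.

Definition unit_images (T : bop) : set R :=
  [set complex.Re `|T x| | x in [set x : H | `|x| <= 1]].

Definition opnorm (T : bop) : R[i] := (sup (unit_images T))%:C.

Lemma normRe (x : H) : (complex.Re `|x|)%:C = `|x|.
Proof. by apply/RRe_real/normr_real. Qed.

Lemma unit_images_has_sup T : has_sup (unit_images T).
Proof.
split; first by exists (complex.Re `|T 0|); exists 0 => //=; rewrite normr0.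
have [M M0 TM] := bop_bounded T; exists (complex.Re M) => _ [x /= x1 <-].
rewrite -lecR normRe RRe_real ?ger0_real// (le_trans (TM x))//.
by rewrite ler_piMr.
Qed.

Lemma opnorm_ub (T : bop) (x : H) : `|x| <= 1 -> `|T x| <= opnorm T.
Proof.
move=> x1; rewrite -normRe lecR; apply: sup_ubound; last by exists x.
by case: (unit_images_has_sup T).
Qed.

Lemma opnorm_le (T : bop) (M : R) :
  (forall x : H, `|x| <= 1 -> `|T x| <= M%:C) -> opnorm T <= M%:C.
Proof.
move=> TM; rewrite lecR; apply: ge_sup => [|_ [x /= x1 <-]].
  by case: (unit_images_has_sup T).
by rewrite -lecR normRe TM.
Qed.

Lemma opnorm_ge0 (T : bop) : 0 <= opnorm T.
Proof. by rewrite (le_trans (normr_ge0 (T 0)))// opnorm_ub// normr0. Qed.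

Lemma ler_opnorm (T : bop) (x : H) : `|T x| <= opnorm T * `|x|.
Proof.
have [->|x0] := eqVneq x 0; first by rewrite linear0 !normr0 mulr0.
have nx0 : 0 < `|x| by rewrite normr_gt0.
have := @opnorm_ub T (`|x|^-1 *: x).
rewrite linearZ !normrZ normfV normr_id mulVf ?gt_eqF// => /(_ (lexx _)).
by rewrite ler_pdivrMl// mulrC.
Qed.

Lemma opnormD (S T : bop) : opnorm (S + T) <= opnorm S + opnorm T.
Proof.
rewrite /opnorm -rmorphD; apply: opnorm_le => x x1; rewrite rmorphD bopD.
by rewrite (le_trans (ler_normD _ _))// lerD// opnorm_ub.
Qed.

Lemma opnormZ_le (a : R[i]) (T : bop) : opnorm (a *: T) <= `|a| * opnorm T.
Proof.
have na : (complex.Re `|a|)%:C = `|a| by exact/RRe_real/normr_real.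
rewrite -na -rmorphM; apply: opnorm_le => x x1; rewrite rmorphM /= na.
by rewrite normrZ ler_wpM2l// opnorm_ub.
Qed.

Lemma opnorm_eq0 (T : bop) : opnorm T = 0 -> T = 0.
Proof.
move=> T0; apply: bopP => x; apply/normr0_eq0/le_anti; rewrite normr_ge0 andbT.
by rewrite (le_trans (ler_opnorm T x))// T0 mul0r.
Qed.

Lemma opnormZ (a : R[i]) (T : bop) : opnorm (a *: T) = `|a| * opnorm T.
Proof.
apply/le_anti; rewrite opnormZ_le /=.
have [->|a0] := eqVneq a 0; first by rewrite normr0 mul0r opnorm_ge0.
have := opnormZ_le a^-1 (a *: T); rewrite scalerA mulVf// scale1r normfV.
by rewrite ler_pdivlMl// normr_gt0.
Qed.

HB.instance Definition _ := Lmodule_isNormed.Build R[i] bop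
  opnormD opnormZ opnorm_eq0.

(* The [S] in question exists and is unique by the Riesz representation
   theorem. *)
Definition adj (T : bop) : bop :=
  xget 0 [set S : bop | forall x y : H, dot (T x) y = dot x (S y)].

(* Limit of the exponential series in operator norm. *)
Definition bop_exp (T : bop) : bop :=
  limn (series (fun k => (k`!%:R : R[i])^-1 *: T ^+ k)).

(* The order on [R[i]] makes [dot (A x) x] real as well as nonnegative. *)
Definition positive (A : bop) := forall x : H, 0 <= dot (A x) x.

Definition calI (A : bop) (m : nat) (T : bop) : bop :=
  \sum_(k < m.+1)
    ((-1) ^+ (m - k) * 'C(m, k)%:R : R[i]) *: (adj T ^+ k * A * T ^+ k).

Definition Omega (A : bop) (m n : nat) (T : bop) : bop :=
  \sum_(k < n.+1)
    ((-1) ^+ (n - k) * 'C(n, k)%:R : R[i]) *: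
      (adj T ^+ k * calI A m T * T ^+ (n - k)).

Definition Lambda (A : bop) (m n : nat) (T : bop) : bop :=
  \sum_(k < n.+1)
    ('C(n, k)%:R : R[i]) *: (adj T ^+ k * calI A m T * T ^+ (n - k)).

Definition isosymmetric (A : bop) (m n : nat) (T : bop) := Omega A m n T = 0.

Definition skew_isosymmetric (A : bop) (m n : nat) (T : bop) :=
  Lambda A m n T = 0.

End BoundedOperators.
Arguments bop {R} H.

(* Main.v *)
Require Import Defs.
From HB Require Import structures.
From mathcomp Require Import all_boot all_order all_algebra.
From mathcomp Require Import complex sesquilinear.
From mathcomp Require Import ring lra.
From mathcomp Require Import all_classical all_reals all_analysis.

(** The proposition is an instance of one identity in the Banach algebra of
bounded operators.  For operators X, B, Y let W_h = (L_X + R_Y)^h B, where L_X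
is left multiplication by X and R_Y right multiplication by Y.  As L_X and R_Y
commute, the binomial formula gives W_h = \sum_j 'C(h, j) X^j B Y^(h-j)
([sandwich]), and exponentiating L_X + R_Y gives, for every scalar c,
  exp(cX) B exp(cY) = \sum_h c^h/h! W_h        ([exp_sandwichZ]).
With B = calI A m T, the choice (X, Y) = (adj T, T) makes W_h the operator
Lambda of order h, and (X, Y) = (adj T, -T) makes it Omega.  In the first case c is
i s k, in the second c is -i s k, and the left-hand sides are those of the
statement because exp(cX)^k = exp(kcX) ([bop_expX]) and the adjoint of
exp(isT) is exp(-is adj T) ([adj_exp]).

If W_n = 0 then W_h = 0 for all h >= n, since W_(h+1) = X W_h + W_h Y
([sandwichS]), so the series stops at n.  Conversely, if the series agrees with
its truncation at n for all c = w s with |w| = 1 and s real, then the remainder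
vanishes, and comparing its first term s^n/n! W_n with the others, which are
O(s^(n+1)), gives W_n = 0 as s tends to 0 ([sandwich_eq0_of_truncated]).

Two facts of functional analysis support this.  The exponential series converges
because bounded operators form a complete space ([bop_complete]).  The adjoint
exists by the Riesz representation theorem ([Riesz_real_functional]), proved by
minimizing |x|^2 - 2 phi(x): by the parallelogram law the near-minimizers form a
Cauchy filter, and its limit represents phi. *)

Set Implicit Arguments.
Unset Strict Implicit.
Unset Printing Implicit Defensive.

Import Order.TTheory GRing.Theory Num.Theory.
Import numFieldNormedType.Exports.

Local Open Scope classical_set_scope.
Local Open Scope ring_scope.
Local Open Scope complex_scope.

(** * Auxiliary facts on real and complex numbers *)

Lemma ReD (R : realType) (a b : R[i]) :
  complex.Re (a + b) = complex.Re a + complex.Re b.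
Proof. by case: a b => [? ?] []. Qed.

Lemma ReZ (R : realType) (t : R) (a : R[i]) :
  complex.Re (t%:C * a) = t * complex.Re a.
Proof. by case: a => [? ?] /=; rewrite mul0r subr0. Qed.

Lemma ReJ (R : realType) (a : R[i]) : complex.Re a^* = complex.Re a.
Proof. by case: a. Qed.

Lemma conj_imaginary (R : realType) (s : R) :
  Num.conj ('i * s%:C : R[i]) = - 'i * s%:C.
Proof.
rewrite rmorphM; congr (_ * _); last exact: conjc_real.
by apply/eqP; rewrite eq_complex /= oppr0 !eqxx.
Qed.

(** A quadratic polynomial in t that stays nonnegative has nonpositive
discriminant.  The degenerate case b = 0 is included, so that vectors of norm 0
need no separate treatment. *)
Lemma discriminant_le (R : realFieldType) (a b c : R) : 0 <= b ->
  (forall t, 0 <= c + 2 * t * a + t ^+ 2 * b) -> a ^+ 2 <= c * b.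
Proof.
move=> b0 h; have [b00|b00] := eqVneq b 0.
  have [->|a0] := eqVneq a 0; first by rewrite b00 mulr0 expr0n.
  have := h (- (c + 1) / (2 * a)); rewrite b00 mulr0 addr0.
  have -> : c + 2 * (- (c + 1) / (2 * a)) * a = - 1 by field.
  by rewrite lerNr oppr0 ler10.
have bp : 0 < b by rewrite lt_neqAle eq_sym b00.
have := h (- a / b); have -> : c + 2 * (- a / b) * a + (- a / b) ^+ 2 * b
  = (c * b - a ^+ 2) / b by field.
by rewrite pmulr_lge0 ?invr_gt0// subr_ge0.
Qed.

(** Lets an estimate hold with an error term that vanishes in the limit. *)
Lemma cvg0_bound_le0 (R : realType) (a : R) (w : nat -> R) :
  (\forall n \near \oo, a <= w n) -> w @ \oo --> 0 -> a <= 0.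
Proof.
move=> aw w0; rewrite -(cvg_lim _ w0)//; apply: limr_ge => //.
by apply/cvg_ex; exists 0.
Qed.

Lemma squeeze_cvg0 (R : realType) (a w : nat -> R) :
  (forall n, 0 <= a n <= w n) ->
  w @ \oo --> 0 -> a @ \oo --> 0.
Proof.
move=> aw w0; apply: (squeeze_cvgr (f := fun=> 0)) w0; last exact: cvg_cst.
exact: nearW.
Qed.

(** * Real-valued norms *)

Section RealNorm.
Context {R : realType} {V : normedModType R[i]}.
Implicit Types (x y : V) (a : R[i]).

(** The norm of V takes values in R[i], where the order is partial; its real
part carries the same information in an ordered field. *)
Definition rnorm x : R := complex.Re `|x|.

Lemma rnormE x : (rnorm x)%:C = `|x|.
Proof. exact/RRe_real/normr_real. Qed.

Lemma rnorm_ge0 x : 0 <= rnorm x.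
Proof. by have := normr_ge0 x; rewrite -rnormE lecR. Qed.

Lemma rnormD x y : rnorm (x + y) <= rnorm x + rnorm y.
Proof. by rewrite -lecR rmorphD /= !rnormE ler_normD. Qed.

Lemma rnormN x : rnorm (- x) = rnorm x.
Proof. by rewrite /rnorm normrN. Qed.

Lemma rnormC x y : rnorm (x - y) = rnorm (y - x).
Proof. by rewrite /rnorm distrC. Qed.

Lemma rnormZ a x : rnorm (a *: x) = complex.Re `|a| * rnorm x.
Proof.
apply: complexI; rewrite rnormE normrZ.
have na : (complex.Re `|a|)%:C = `|a| by exact/RRe_real/normr_real.
by rewrite -na -rnormE -rmorphM.
Qed.

Lemma rnorm0 : rnorm 0 = 0.
Proof. by rewrite /rnorm normr0. Qed.

Lemma rnorm0_eq0 x : rnorm x = 0 -> x = 0.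
Proof. by move=> x0; apply: normr0_eq0; rewrite -rnormE x0. Qed.

Lemma rnorm_sum I (r : seq I) (P : pred I) (F : I -> V) :
  rnorm (\sum_(i <- r | P i) F i) <= \sum_(i <- r | P i) rnorm (F i).
Proof.
elim/big_ind2 : _ => [|x a y b xa yb|//]; first by rewrite rnorm0.
by rewrite (le_trans (rnormD _ _))// lerD.
Qed.

(** Balls of V have complex radii, only real ones of which matter; this reduces
convergence in V to convergence of a real function. *)
Lemma cvg_rnorm (T : Type) (F : set_system T) {FF : Filter F} (f : T -> V) l :
  (rnorm (l - f t) @[t --> F] --> (0 : R)) <-> (f @ F --> l).
Proof.
split=> [/cvgr0Pnorm_lt fl|/cvgrPdist_lt fl].
  apply/cvgrPdist_lt => e e0.
  have eR : (complex.Re e)%:C = e by apply/RRe_real/gtr0_real.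
  have /fl : 0 < complex.Re e by rewrite -ltcR eR.
  apply: filterS => t; rewrite ger0_norm ?rnorm_ge0// => tl.
  by rewrite -rnormE -eR ltcR.
apply/cvgr0Pnorm_lt => e e0.
have /fl : 0 < e%:C by rewrite ltcR.
by apply: filterS => t; rewrite ger0_norm ?rnorm_ge0// -rnormE ltcR.
Qed.

End RealNorm.

(** * The real inner product and the Riesz representation theorem *)

Section Riesz.
Context {R : realType} {H : hilbertType R}.
Implicit Types x y z : H.

Lemma dotDl x y z : dot (x + y) z = dot x z + dot y z.
Proof. exact: linearDl. Qed.

Lemma dotDr x y z : dot x (y + z) = dot x y + dot x z.
Proof. exact: linearDr. Qed.

Lemma dotZl a x y : dot (a *: x) y = a * dot x y.
Proof. exact: linearZl_LR. Qed.

Lemma dotZr a x y : dot x (a *: y) = a^* * dot x y.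
Proof. exact: linearZr_LR. Qed.

Lemma dotC x y : dot x y = (dot y x)^*.
Proof. by have := hermitian_subproof (s := dot) x y; rewrite expr0 mul1r. Qed.

Definition rdot x y : R := complex.Re (dot x y).

Lemma rdotC x y : rdot x y = rdot y x.
Proof. by rewrite /rdot dotC ReJ. Qed.

Lemma rdotDl x y z : rdot (x + y) z = rdot x z + rdot y z.
Proof. by rewrite /rdot dotDl ReD. Qed.

Lemma rdotZl (t : R) x y : rdot (t%:C *: x) y = t * rdot x y.
Proof. by rewrite /rdot dotZl ReZ. Qed.

Lemma rdotxx x : rdot x x = rnorm x ^+ 2.
Proof.
apply: complexI; rewrite rmorphXn /= rnormE normr_dotE RRe_real//.
by rewrite -normr_dotE rpredX// normr_real.
Qed.

Lemma sqr_rnormDZ (t : R) x y :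
  rnorm (x + t%:C *: y) ^+ 2 =
  rnorm x ^+ 2 + 2 * t * rdot x y + t ^+ 2 * rnorm y ^+ 2.
Proof.
rewrite -!rdotxx rdotDl (rdotC x (_ + _)) (rdotC (_ *: _) (_ + _)).
rewrite !rdotDl !rdotZl.
by rewrite (rdotC x (_ *: _)) (rdotC y (_ *: _)) !rdotZl (rdotC y x); ring.
Qed.

(** The squared norm of x + t y is a nonnegative quadratic polynomial in t. *)
Lemma rdot_CauchySchwarz x y : `|rdot x y| <= rnorm x * rnorm y.
Proof.
rewrite -ler_sqr ?nnegrE ?mulr_ge0 ?rnorm_ge0// exprMn real_normK ?num_real//.
apply: discriminant_le => [|t]; first exact: sqr_ge0.
by rewrite -sqr_rnormDZ sqr_ge0.
Qed.

Lemma rdotBl x y z : rdot (x - y) z = rdot x z - rdot y z.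
Proof.
by rewrite rdotDl -scaleN1r -(rmorphN1 (real_complex R)) rdotZl mulN1r.
Qed.

Lemma rdot_inj x y : (forall z, rdot z x = rdot z y) -> x = y.
Proof.
move=> xy; apply/eqP; rewrite -subr_eq0; apply/eqP/rnorm0_eq0/eqP.
by rewrite -sqrf_eq0 -rdotxx rdotBl (rdotC x) (rdotC y) xy subrr.
Qed.

Section RealFunctional.
Variables (phi : H -> R) (M : R).
Hypothesis phiD : forall x y, phi (x + y) = phi x + phi y.
Hypothesis phiZ : forall (t : R) x, phi (t%:C *: x) = t * phi x.
Hypothesis phiM : forall x, `|phi x| <= M * rnorm x.

Let J x := rnorm x ^+ 2 - 2 * phi x.

Let J_lb x : - M ^+ 2 <= J x.
Proof.
rewrite /J; have := phiM x; have := sqr_ge0 (rnorm x - M).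
rewrite ler_norml sqrrB => h /andP[_ h2]; lra.
Qed.

Let infJ := inf (range J).

Let has_infJ : has_inf (range J).
Proof.
split; first by exists (J 0); exists 0.
by exists (- M ^+ 2) => _ [x _ <-].
Qed.

Let infJ_le x : infJ <= J x.
Proof. by apply: ge_inf; [case: has_infJ|exists x]. Qed.

Let almost_min e : 0 < e -> exists x, J x < infJ + e.
Proof.
by move=> e0; have [_ [x _ <-] xe] := inf_adherent e0 has_infJ; exists x.
Qed.

(** The midpoint of x and y has J at least infJ, which the parallelogram law
turns into a bound on the distance between x and y. *)
Let J_parallelogram e x y : J x < infJ + e -> J y < infJ + e ->
  rnorm (x - y) ^+ 2 <= 4 * e.
Proof.
move=> xe ye; have := infJ_le ((2^-1)%:C *: (x + y)).
rewrite /J in xe ye *; rewrite phiZ phiD.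
have -> : rnorm ((2^-1)%:C *: (x + y)) ^+ 2
  = 4^-1 * (rnorm x ^+ 2 + 2 * rdot x y + rnorm y ^+ 2).
  have := sqr_rnormDZ 1 x y; rewrite scale1r mulr1 expr1n mul1r => <-.
  by rewrite -!rdotxx rdotZl rdotC rdotZl; field.
have -> : rnorm (x - y) ^+ 2 = rnorm x ^+ 2 - 2 * rdot x y + rnorm y ^+ 2.
  have := sqr_rnormDZ (-1) x y; rewrite rmorphN1 scaleN1r => ->; ring.
lra.
Qed.

(** A filter of near-minimizers avoids choosing a minimizing sequence. *)
Let minimizing : set_system H :=
  filter_from [set e : R | 0 < e] (fun e => [set x | J x < infJ + e]).

Let minimizing_filter : ProperFilter minimizing.
Proof.
apply: filter_from_proper; last by move=> e /almost_min.
apply: filter_from_filter; first by exists 1 => /=.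
move=> e e' /= e0 e'0; exists (Num.min e e'); first by rewrite /= lt_min e0.
by move=> x /=; rewrite -ltrBlDl lt_min !ltrBlDl => /andP.
Qed.

Let minimizing_cvg : cvg minimizing.
Proof.
have FF := minimizing_filter; apply: cauchy_cvg; apply: cauchy_exP => e e0.
have eR : (complex.Re e)%:C = e by apply/RRe_real/gtr0_real.
set r := complex.Re e in eR.
have r0 : 0 < r by rewrite -ltcR eR.
have d0 : 0 < r ^+ 2 / 8 by rewrite divr_gt0// exprn_gt0.
have [x xe] := almost_min d0; exists x; exists (r ^+ 2 / 8) => //= y ye.
rewrite -ball_normE /ball_/= -eR -rnormE ltcR.
rewrite -ltr_sqr ?nnegrE ?rnorm_ge0 ?ltW//.
apply: le_lt_trans (J_parallelogram xe ye) _.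
have : 0 < r ^+ 2 by rewrite exprn_gt0.
lra.
Qed.

(** A near-minimizer is nearly stationary in the direction z, and the derivative
of J at x in that direction is twice rdot x z - phi z. *)
Let almost_min_represents e x z : J x < infJ + e ->
  (rdot x z - phi z) ^+ 2 <= e * rnorm z ^+ 2.
Proof.
move=> xe; apply: discriminant_le => [|t]; first exact: sqr_ge0.
have := infJ_le (x + t%:C *: z); rewrite /J in xe *.
rewrite sqr_rnormDZ phiD phiZ; lra.
Qed.

(** The limit v of the near-minimizers satisfies rdot v z = phi z for each z, as
both rdot (v - x) z and rdot x z - phi z become small along the filter. *)
Lemma Riesz_real_functional : exists v, forall z, phi z = rdot v z.
Proof.
have FF := minimizing_filter; set v := lim minimizing; exists v => z.
apply/eqP; rewrite eq_sym -subr_eq0 -normr_le0.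
apply/ler_addgt0Pl => e e0; rewrite addr0.
(* Adding 1 allows division by b even when z has norm 0. *)
set b := rnorm z + 1.
have b0 : 0 < b by rewrite ltr_wpDl ?rnorm_ge0.
have d0 : 0 < e / (2 * b) by rewrite divr_gt0// mulr_gt0.
have vx : minimizing [set x | rnorm (v - x) < e / (2 * b)].
  have /cvg_rnorm/cvgr0Pnorm_lt/(_ _ d0) : id @ minimizing --> v.
    exact: minimizing_cvg.
  by apply: filterS => x; rewrite /= ger0_norm ?rnorm_ge0.
have : minimizing [set x | J x < infJ + (e / (2 * b)) ^+ 2].
  by exists ((e / (2 * b)) ^+ 2) => //=; rewrite exprn_gt0.
move=> /(filterI vx)/filter_ex[x [/= vxe /(almost_min_represents z) xz]].
have {xz} : `|rdot x z - phi z| <= e / (2 * b) * rnorm z.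
  rewrite -ler_sqr ?nnegrE ?(mulr_ge0 (ltW d0)) ?rnorm_ge0//.
  by rewrite exprMn real_normK ?num_real.
have -> : rdot v z - phi z = rdot (v - x) z + (rdot x z - phi z).
  by have := rdotDl (v - x) x z; rewrite subrK => ->; rewrite addrA.
move=> xz; rewrite (le_trans (ler_normD _ _))//.
have := rdot_CauchySchwarz (v - x) z.
have zb : rnorm z <= b by rewrite lerDl.
have : rnorm (v - x) * rnorm z <= e / (2 * b) * b.
  by rewrite ler_pM ?rnorm_ge0// ltW.
have : e / (2 * b) * rnorm z <= e / (2 * b) * b by rewrite ler_wpM2l// ltW.
have -> : e / (2 * b) * b = e / 2 by field; rewrite gt_eqF.
lra.
Qed.

End RealFunctional.

End Riesz.

(** * Existence and algebra of adjoints *)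

Section Adjoint.
Context {R : realType} {H : hilbertType R}.
Implicit Types (x y z : H) (S T : bop H).

Lemma rnorm_apply_le T x : rnorm (T x) <= rnorm T * rnorm x.
Proof. by rewrite -lecR rmorphM /= !rnormE ler_opnorm. Qed.

(** The imaginary part of f x is minus the real part of f (i x).  Hence
identities between complex inner products may be proved for real ones. *)
Lemma eq_scalar_Re (f g : H -> R[i]) : scalar f -> scalar g ->
  (forall x, complex.Re (f x) = complex.Re (g x)) -> f =1 g.
Proof.
move=> lf lg fg x.
have f0 : f 0 = 0 by have := lf (-1) 0 0; rewrite scaler0 addr0 mulN1r addNr.
have g0 : g 0 = 0 by have := lg (-1) 0 0; rewrite scaler0 addr0 mulN1r addNr.
have := fg ('i *: x); have := lf 'i x 0; have := lg 'i x 0.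
rewrite f0 g0 !addr0 => -> ->.
rewrite (mulrC _ (f x)) (mulrC _ (g x)) !ReiNIm => /oppr_inj fgi.
by apply/eqP; rewrite eq_complex fg fgi !eqxx.
Qed.

Lemma dotl_scalar T y : scalar (fun x => dot (T x) y).
Proof. by move=> a x z; rewrite linearP dotDl dotZl. Qed.

Lemma rdot_adjoint S T : (forall x y, rdot (S x) y = rdot x (T y)) ->
  forall x y, dot (S x) y = dot x (T y).
Proof.
move=> ST x y.
apply: (eq_scalar_Re (dotl_scalar S y) (dotl_scalar (1 : bop H) (T y))) => z.
exact: ST.
Qed.

(** S y represents x |-> rdot (T x) y.  Linearity of S follows from uniqueness
of the representing vector, and boundedness from |S y|^2 = rdot (T (S y)) y. *)
Lemma adjoint_exists T :
  exists S, forall x y, dot (T x) y = dot x (S y).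
Proof.
have TD x y z : rdot (T (x + y)) z = rdot (T x) z + rdot (T y) z.
  by rewrite linearD rdotDl.
have TZ (t : R) x z : rdot (T (t%:C *: x)) z = t * rdot (T x) z.
  by rewrite linearZ rdotZl.
have TM z x : `|rdot (T x) z| <= rnorm T * rnorm z * rnorm x.
  rewrite (le_trans (rdot_CauchySchwarz _ _))// mulrAC ler_wpM2r ?rnorm_ge0//.
  exact: rnorm_apply_le.
have /choice[S ST] : forall y, exists v, forall x, rdot (T x) y = rdot x v.
  move=> y; have [v vP] := Riesz_real_functional
    (fun x x' => TD x x' y) (fun t x => TZ t x y) (TM y).
  by exists v => x; rewrite vP rdotC.
have Slin : linear S.
  move=> a x y; apply: rdot_inj => z.
  have dST u v : dot (T v) u = dot v (S u).
    apply: (eq_scalar_Re (dotl_scalar T u) (dotl_scalar (1 : bop H) (S u))).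
    by move=> w; exact: ST.
  by rewrite /rdot -dST !dotDr !dotZr !dST.
have Sbd : S \in bounded_operator.
  apply/boundedP; split=> //; exists (rnorm T)%:C.
    by rewrite ler0c rnorm_ge0.
  move=> y; rewrite -!rnormE -rmorphM lecR.
  have [->|Sy0] := eqVneq (rnorm (S y)) 0; first by rewrite mulr_ge0 ?rnorm_ge0.
  have Sy : 0 < rnorm (S y) by rewrite lt_neqAle eq_sym Sy0 rnorm_ge0.
  rewrite -(ler_pM2l Sy) -expr2 -rdotxx -ST (le_trans (ler_norm _))//.
  by rewrite (le_trans (TM _ _))// mulrC.
by exists (Bop Sbd); exact: rdot_adjoint.
Qed.

Lemma dot_adj T x y : dot (T x) y = dot x (adj T y).
Proof.
have [S ST] := adjoint_exists T; move: x y.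
rewrite /adj; case: xgetP => [S' -> //|].
by move=> /(_ S).
Qed.

Lemma adjP S T : (forall x y, dot (T x) y = dot x (S y)) -> adj T = S.
Proof.
move=> TS; apply: bopP => y; apply: rdot_inj => z.
by rewrite /rdot -TS dot_adj.
Qed.

Lemma adjZ (c : R[i]) T : adj (c *: T) = c^* *: adj T.
Proof.
apply: adjP => x y; rewrite dotZl dotZr dot_adj; congr (_ * _).
by symmetry; exact: (conjcK c).
Qed.

Lemma adjD S T : adj (S + T) = adj S + adj T.
Proof.
apply: adjP => x y.
rewrite -[LHS]/(dot (S x + T x) y) -[RHS]/(dot x (adj S y + adj T y)).
by rewrite dotDl dotDr !dot_adj.
Qed.

Lemma adjM S T : adj (S * T) = adj T * adj S.
Proof.
apply: adjP => x y.
by rewrite -[LHS]/(dot (S (T x)) y) -[RHS]/(dot x (adj T (adj S y))) !dot_adj.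
Qed.

Lemma adjX T k : adj (T ^+ k) = adj T ^+ k.
Proof.
elim: k => [|k IH]; first by rewrite !expr0; exact: adjP.
by rewrite exprS exprSr adjM IH.
Qed.

Lemma adj_sum I (r : seq I) (P : pred I) (F : I -> bop H) :
  adj (\sum_(i <- r | P i) F i) = \sum_(i <- r | P i) adj (F i).
Proof.
elim/big_rec2 : _ => [|i S T _ <-]; last exact: adjD.
by apply: (addrI (adj 0)); rewrite -adjD !addr0.
Qed.

(** Pairs of mutually adjoint operators form a closed set, by Cauchy-Schwarz. *)
Lemma adj_lim (u v : nat -> bop H) S T :
  (forall n x y, dot (u n x) y = dot x (v n y)) ->
  u @ \oo --> T -> v @ \oo --> S -> adj T = S.
Proof.
move=> uv /cvg_rnorm uT /cvg_rnorm vS; apply/adjP/rdot_adjoint => x y.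
apply/eqP; rewrite -subr_eq0 -normr_le0.
apply: (cvg0_bound_le0 (w := fun n =>
    (rnorm (T - u n) + rnorm (S - v n)) * (rnorm x * rnorm y))).
  apply: nearW => n; have -> : rdot (T x) y - rdot x (S y) =
      rdot ((T - u n) x) y - rdot ((S - v n) y) x.
    rewrite [(T - u n) x]/(T x - u n x) [(S - v n) y]/(S y - v n y) !rdotBl.
    by rewrite (rdotC (S y)) (rdotC (v n y)) /rdot uv; ring.
  rewrite (le_trans (ler_normB _ _))// mulrDl lerD//.
    rewrite (le_trans (rdot_CauchySchwarz _ _))// mulrA ler_wpM2r ?rnorm_ge0//.
    exact: rnorm_apply_le.
  rewrite (le_trans (rdot_CauchySchwarz _ _))// mulrCA mulrC.
  rewrite ler_wpM2l ?rnorm_ge0//.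
  exact: rnorm_apply_le.
rewrite -[X in _ --> X](mul0r (rnorm x * rnorm y)); apply: cvgMl.
by rewrite -[X in _ --> X](addr0 0); exact: cvgD.
Qed.

End Adjoint.

(** * The Banach algebra of bounded operators *)

Section OperatorAlgebra.
Context {R : realType} {H : hilbertType R}.
Implicit Types (S T : bop H) (x : H).

Lemma rnorm_bop_le T (M : R) : 0 <= M ->
  (forall x, rnorm (T x) <= M * rnorm x) -> rnorm T <= M.
Proof.
move=> M0 TM; rewrite -lecR rnormE; apply: opnorm_le => x x1.
rewrite -rnormE lecR (le_trans (TM x))// ler_piMr//.
by rewrite -lecR rnormE.
Qed.

Lemma rnormM S T : rnorm (S * T) <= rnorm S * rnorm T.
Proof.
apply: rnorm_bop_le => [|x]; first by rewrite mulr_ge0 ?rnorm_ge0.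
rewrite -mulrA (le_trans (rnorm_apply_le S (T x)))// ler_wpM2l ?rnorm_ge0//.
exact: rnorm_apply_le.
Qed.

Lemma rnormX T n : rnorm (T ^+ n) <= rnorm T ^+ n.
Proof.
elim: n => [|n IH].
  by rewrite !expr0; apply: rnorm_bop_le => // x; rewrite mul1r.
by rewrite !exprS (le_trans (rnormM _ _))// ler_wpM2l ?rnorm_ge0.
Qed.

Lemma scaleMl a S T : (a *: S) * T = a *: (S * T).
Proof. exact: bopP. Qed.

Lemma scaleMr a S T : S * (a *: T) = a *: (S * T).
Proof. by apply: bopP => x; exact: linearZ. Qed.

Lemma scaleX a T n : (a *: T) ^+ n = a ^+ n *: T ^+ n.
Proof.
elim: n => [|n IH]; first by rewrite !expr0 scale1r.
by rewrite !exprS IH scaleMl scaleMr scalerA.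
Qed.

Lemma bop_cvgM (u v : nat -> bop H) S T :
  u @ \oo --> S -> v @ \oo --> T -> u n * v n @[n --> \oo] --> S * T.
Proof.
move=> /cvg_rnorm uS /cvg_rnorm vT; apply/cvg_rnorm.
apply: (squeeze_cvg0 (w := fun n => rnorm (S - u n) * rnorm T +
    (rnorm S + rnorm (S - u n)) * rnorm (T - v n))) => [n|].
  rewrite rnorm_ge0 /=.
  have -> : S * T - u n * v n = (S - u n) * T + u n * (T - v n).
    by rewrite mulrBl mulrBr addrA subrK.
  rewrite (le_trans (rnormD _ _))// lerD ?rnormM//.
  rewrite (le_trans (rnormM _ _))// ler_wpM2r ?rnorm_ge0// rnormC.
  by rewrite -{1}(subrK S (u n)) addrC rnormD.
rewrite -[X in _ --> X](addr0 0); apply: cvgD.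
  rewrite -[X in _ --> X](mul0r (rnorm T)).
  by apply: cvgM => //; exact: cvg_cst.
rewrite -[X in _ --> X](mulr0 (rnorm S + 0)); apply: cvgM => //.
by apply: cvgD => //; exact: cvg_cst.
Qed.

Lemma cauchy_rnorm (F : set_system (bop H)) : ProperFilter F -> cauchy F ->
  forall e : R, 0 < e -> exists T, F [set S | rnorm (T - S) < e].
Proof.
move=> FF /(cauchyP (R := R[i])) cF e e0.
have [|T FT] := cF e%:C; first by rewrite ltcR.
exists T; apply: filterS FT => S; rewrite -ball_normE /ball_/=.
by rewrite -rnormE ltcR.
Qed.

(** A Cauchy filter of operators converges pointwise, since H is complete.  The
pointwise limit inherits linearity, and the Cauchy condition is uniform on the
unit ball, so the limit is bounded and convergence holds in operator norm. *)
Lemma bop_complete (F : set_system (bop H)) :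
  ProperFilter F -> cauchy F -> cvg F.
Proof.
move=> FF /(cauchy_rnorm FF) cF.
have Fx x : cvg (T x @[T --> F]).
  apply: cauchy_cvg; apply: cauchy_exP => e e0.
  have eR : (complex.Re e)%:C = e by apply/RRe_real/gtr0_real.
  have r0 : 0 < complex.Re e by rewrite -ltcR eR.
  have x1 : 0 < rnorm x + 1 by rewrite ltr_wpDl ?rnorm_ge0.
  have [T FT] := cF _ (divr_gt0 r0 x1); exists (T x).
  suff : F [set S : bop H | ball (T x) e (S x)] by [].
  apply: filterS FT => S TS; rewrite /= -ball_normE /ball_/= -eR -rnormE ltcR.
  rewrite -[T x - S x]/((T - S) x) (le_lt_trans (rnorm_apply_le _ _))//.
  apply: (@le_lt_trans _ _ (rnorm (T - S) * (rnorm x + 1))).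
    by rewrite ler_wpM2l ?rnorm_ge0// lerDl.
  by rewrite -ltr_pdivlMr.
pose E x := lim (T x @[T --> F]).
have E_lin : linear E.
  move=> a x y.
  transitivity (lim ((fun T : bop H => a *: T x + T y) @ F)).
    by congr (lim (_ @ F)); apply/funext => T; rewrite linearP.
  apply: cvg_lim => //.
  by apply: cvgD; [apply: cvgZl_tmp; exact: Fx|exact: Fx].
have E_close T e : F [set S | rnorm (T - S) < e] ->
    forall x, rnorm (E x - T x) <= e * rnorm x.
  move=> FT x; apply/ler_addgt0Pl => r r0.
  have Fr : F [set S : bop H | rnorm (E x - S x) < r].
    have /cvg_rnorm/cvgr0Pnorm_lt/(_ _ r0) := Fx x.
    suff sub : [set S : bop H | `|rnorm (E x - S x)| < r] `<=`
        [set S : bop H | rnorm (E x - S x) < r] by exact: filterS sub.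
    by move=> S /=; rewrite ger0_norm ?rnorm_ge0.
  have [S [/= TS ES]] := filter_ex (filterI FT Fr).
  rewrite -(subrKA (S x)) (le_trans (rnormD _ _))// lerD ?(ltW ES)// rnormC.
  rewrite -[T x - S x]/((T - S) x) (le_trans (rnorm_apply_le _ _))//.
  by rewrite ler_wpM2r ?rnorm_ge0// ltW.
have E_bd : E \in bounded_operator.
  have [T FT] := cF 1 ltr01; apply/boundedP; split=> //.
  exists (1 + rnorm T)%:C; first by rewrite ler0c addr_ge0 ?rnorm_ge0.
  move=> x; rewrite -!rnormE -rmorphM lecR -{1}(subrK (T x) (E x)).
  by rewrite (le_trans (rnormD _ _))// mulrDl lerD ?rnorm_apply_le ?E_close.
apply/cvg_ex; exists (Bop E_bd); apply/(cvg_rnorm id)/cvgr0Pnorm_lt => e e0.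
have e4 : 0 < e / 4 by rewrite divr_gt0.
have [T FT] := cF _ e4; apply: filterS (FT) => S /= TS.
rewrite ger0_norm ?rnorm_ge0// -(subrKA T) (le_lt_trans (rnormD _ _))//.
have : rnorm (Bop E_bd - T) <= e / 4.
  by apply: rnorm_bop_le => [|x]; [rewrite ltW|exact: E_close].
lra.
Qed.

HB.instance Definition _ := Uniform_isComplete.Build (bop H) bop_complete.

(** Completeness turns convergence of a real majorant into convergence in
operator norm. *)
Lemma cvg_series_rnorm (u : nat -> bop H) (v : nat -> R) :
  (forall n, rnorm (u n) <= v n) -> cvgn (series v) -> cvgn (series u).
Proof.
move=> uv /cauchy_cvgP/cauchy_seriesP cv.
apply/cauchy_cvgP/cauchy_seriesP => e e0.
have eR : (complex.Re e)%:C = e by apply/RRe_real/gtr0_real.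
have /cv : 0 < complex.Re e by rewrite -ltcR eR.
apply: filterS => -[p q] /= vpq; rewrite -eR -rnormE ltcR.
rewrite (le_lt_trans (rnorm_sum _ _ _))// (le_lt_trans _ vpq)//.
by rewrite (le_trans _ (ler_norm _))// ler_sum.
Qed.

End OperatorAlgebra.

(** * Exponentials around a fixed operator *)

(** Indexing of a Cauchy product: the product of two partial sums is a sum over
a square, the partial sum of the product series is a sum over a triangle. *)
Lemma square_sub_triangle (V : zmodType) (F : nat -> nat -> V) N :
  \sum_(i < N) \sum_(j < N) F i j - \sum_(h < N) \sum_(i < h.+1) F i (h - i)%N =
  \sum_(i < N) \sum_(j < N | (N <= i + j)%N) F i j.
Proof.
have -> : \sum_(h < N) \sum_(i < h.+1) F i (h - i)%N =
          \sum_(i < N) \sum_(j < N | (i + j < N)%N) F i j.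
  transitivity (\sum_(h < N) \sum_(i < N | (i <= h)%N) F i (h - i)%N).
    apply: eq_bigr => h _.
    by rewrite (big_ord_widen N (fun i => F i (h - i)%N)).
  rewrite (exchange_big_dep predT)//=; apply: eq_bigr => i _.
  rewrite -(big_geq_mkord _ _ predT (fun h => F i (h - i)%N)).
  rewrite -{1}(add0n (i : nat)).
  rewrite big_addn -(big_mkord (fun j => (i + j < N)%N) (F i)).
  rewrite (big_nat_widen _ _ _ _ _ (leq_subr i N)); apply: eq_big => [j|j _].
    by rewrite /= ltn_subRL.
  by rewrite addnK.
rewrite -sumrB; apply: eq_bigr => i _.
rewrite (bigID (fun j : 'I_N => (i + j < N)%N))/= addrAC subrr add0r.
by apply: eq_bigl => j; rewrite -leqNgt.
Qed.

Lemma bin_div_fact (F : numFieldType) (h j : nat) : (j <= h)%N ->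
  (h`!%:R : F)^-1 * 'C(h, j)%:R = j`!%:R^-1 * (h - j)`!%:R^-1.
Proof.
move=> jh; have f0 k : (k`!%:R : F) != 0 by rewrite pnatr_eq0 -lt0n fact_gt0.
have : ('C(h, j) * (j`! * (h - j)`!))%:R = h`!%:R :> F by rewrite bin_fact.
rewrite natrM [X in _ * X]natrM; move: (f0 h) (f0 j) (f0 (h - j)%N).
move: (h`!%:R) (j`!%:R) ((h - j)`!%:R) ('C(h, j)%:R) => a b c d a0 b0 c0 dE.
by apply: (mulfI a0); rewrite mulVKf// -[in RHS]dE; field; rewrite b0 c0.
Qed.

Section Exponential.
Context {R : realType} {H : hilbertType R}.
Implicit Types (S T X Y B : bop H) (x : H) (a b c : R[i]).

Let expt T k : bop H := (k`!%:R : R[i])^-1 *: T ^+ k.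

Let norm_inv_fact (k : nat) : complex.Re `|(k`!%:R : R[i])^-1| = (k`!%:R)^-1.
Proof.
have -> : (k`!%:R : R[i]) = (k`!%:R)%:C by rewrite rmorph_nat.
by rewrite -fmorphV normc_def /= expr0n addr0 sqrtr_sqr ger0_norm ?invr_ge0.
Qed.

Lemma bop_exp_cvg T : series (expt T) @ \oo --> bop_exp T.
Proof.
apply: (@cvg_series_rnorm _ _ _ (exp_coeff (rnorm T))) => [n|].
  rewrite rnormZ norm_inv_fact /exp_coeff /= mulrC.
  by rewrite ler_wpM2r ?invr_ge0 ?rnormX.
exact: is_cvg_series_exp_coeff.
Qed.

(** The h-th power of the map Z |-> X * Z + Z * Y, applied to B; see
[sandwichS]. *)
Definition sandwich X Y B h : bop H :=
  \sum_(j < h.+1) ('C(h, j)%:R : R[i]) *: (X ^+ j * B * Y ^+ (h - j)).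

Lemma sandwich0 X Y B : sandwich X Y B 0 = B.
Proof. by rewrite /sandwich big_ord1 !expr0 mul1r mulr1 scale1r. Qed.

Lemma sandwichS X Y B h :
  sandwich X Y B h.+1 = X * sandwich X Y B h + sandwich X Y B h * Y.
Proof.
rewrite /sandwich [LHS]big_ord_recl /= mulr_sumr mulr_suml.
under eq_bigr do rewrite /bump /= add1n subSS binS natrD scalerDl.
rewrite big_split/= addrA addrC; congr (_ + _).
  by apply: eq_bigr => j _; rewrite scaleMr exprS !mulrA.
transitivity (\sum_(j < h.+2)
    ('C(h, j)%:R : R[i]) *: (X ^+ j * B * Y ^+ (h.+1 - j))).
  by rewrite [RHS]big_ord_recl /= !bin0; congr (_ + _); apply: eq_bigr.
rewrite big_ord_recr /= bin_small// scale0r addr0.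
apply: eq_bigr => j _; rewrite scaleMl -[in RHS]mulrA -exprSr subSn//.
by rewrite -ltnS.
Qed.

Lemma sandwich_eq0 X Y B n : sandwich X Y B n = 0 ->
  forall h, (n <= h)%N -> sandwich X Y B h = 0.
Proof.
move=> Wn h /subnKC <-; elim: (h - n)%N => [|d IH]; first by rewrite addn0.
by rewrite addnS sandwichS IH mulr0 mul0r addr0.
Qed.

Lemma sandwichZ c X Y B h :
  sandwich (c *: X) (c *: Y) B h = c ^+ h *: sandwich X Y B h.
Proof.
rewrite /sandwich scaler_sumr; apply: eq_bigr => j _.
rewrite !scaleX scaleMr !scaleMl !scalerA; congr (_ *: _).
have jh : (j <= h)%N by rewrite -ltnS.
by rewrite -exprD (subnK jh) mulrC.
Qed.

Lemma rnorm_sandwich X Y B h :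
  rnorm (sandwich X Y B h) <= (rnorm X + rnorm Y) ^+ h * rnorm B.
Proof.
elim: h => [|h IH]; first by rewrite sandwich0 expr0 mul1r.
rewrite sandwichS (le_trans (rnormD _ _))// exprS -mulrA mulrDl lerD//.
  by rewrite (le_trans (rnormM _ _))// ler_wpM2l ?rnorm_ge0.
by rewrite mulrC (le_trans (rnormM _ _))// ler_wpM2r ?rnorm_ge0.
Qed.

(** Mertens' theorem for the three-factor product.  The difference between the
product of partial sums and the partial sum of the sandwiches is a sum over the
pairs (i, j) with i + j >= N.  Its norm is at most |B| times the same difference
for the real exponential series of |X| and |Y|, which tends to 0 because
expR (|X| + |Y|) = expR |X| * expR |Y|. *)
Lemma exp_sandwich X Y B :
  series (fun h => (h`!%:R : R[i])^-1 *: sandwich X Y B h) @ \oo -->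
  bop_exp X * B * bop_exp Y.
Proof.
set Q := series _.
pose P N := series (expt X) N * B * series (expt Y) N.
have PE : P @ \oo --> bop_exp X * B * bop_exp Y.
  apply: bop_cvgM; last exact: bop_exp_cvg.
  by apply: bop_cvgM; [exact: bop_exp_cvg|exact: cvg_cst].
suff PQ : P n - Q n @[n --> \oo] --> 0.
  have -> : Q = (fun n => P n - (P n - Q n)).
    by apply/funext => n; rewrite opprB addrC subrK.
  by rewrite -[X in _ --> X]subr0; exact: cvgB.
apply/cvg_rnorm.
pose x := rnorm X; pose y := rnorm Y.
pose p N := series (exp_coeff x) N * series (exp_coeff y) N
            - series (exp_coeff (x + y)) N.
apply: (squeeze_cvg0 (w := fun N => p N * rnorm B)) => [N|]; last first.
  rewrite -[X in _ --> X](mul0r (rnorm B)); apply: cvgM; last exact: cvg_cst.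
  rewrite -[X in _ --> X](subrr (expR (x + y))) {1}expRD.
  apply: cvgB; last exact: is_cvg_series_exp_coeff.
  by apply: cvgM; exact: is_cvg_series_exp_coeff.
rewrite rnorm_ge0 sub0r rnormN /=.
pose F i j := (i`!%:R^-1 * j`!%:R^-1 : R[i]) *: (X ^+ i * B * Y ^+ j).
have -> : P N - Q N = \sum_(i < N) \sum_(j < N | (N <= i + j)%N) F i j.
  rewrite -square_sub_triangle; congr (_ - _).
    rewrite /P /series /= !big_mkord !mulr_suml; apply: eq_bigr => i _.
    rewrite mulr_sumr; apply: eq_bigr => j _.
    by rewrite scaleMr !scaleMl scalerA mulrC.
  rewrite /Q /series /= big_mkord; apply: eq_bigr => h _.
  rewrite /sandwich scaler_sumr; apply: eq_bigr => j _.
  have jh : (j <= h)%N by rewrite -ltnS.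
  by rewrite scalerA (bin_div_fact _ jh).
pose f i j : R := exp_coeff x i * exp_coeff y j.
have -> : p N = \sum_(i < N) \sum_(j < N | (N <= i + j)%N) f i j.
  rewrite -square_sub_triangle; congr (_ - _).
    rewrite /series /= !big_mkord !mulr_suml; apply: eq_bigr => i _.
    by rewrite mulr_sumr.
  rewrite /series /= big_mkord; apply: eq_bigr => h _.
  rewrite /exp_coeff /= addrC exprDn mulr_suml; apply: eq_bigr => j _.
  rewrite /f /exp_coeff /= -mulr_natr.
  have jh : (j <= h)%N by rewrite -ltnS.
  by rewrite mulrACA -(bin_div_fact _ jh) (mulrC (y ^+ _)) mulrA mulrAC.
rewrite mulr_suml (le_trans (rnorm_sum _ _ _))// ler_sum// => i _.
rewrite mulr_suml (le_trans (rnorm_sum _ _ _))// ler_sum// => j _.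
rewrite /F -scalerA !rnormZ !norm_inv_fact /f /exp_coeff /=.
have -> : x ^+ i / i`!%:R * (y ^+ j / j`!%:R) * rnorm B =
  (i`!%:R)^-1 * ((j`!%:R)^-1 * (x ^+ i * rnorm B * y ^+ j)) by ring.
rewrite !ler_wpM2l ?invr_ge0//.
rewrite (le_trans (rnormM _ _))// ler_pM ?rnorm_ge0 ?rnormX//.
by rewrite (le_trans (rnormM _ _))// ler_wpM2r ?rnorm_ge0 ?rnormX.
Qed.

End Exponential.

(** * The truncated expansion *)

Section Characterization.
Context {R : realType} {H : hilbertType R}.
Implicit Types (S T X Y B : bop H) (x : H) (a b c : R[i]).

(** The case B = 1 of [exp_sandwich]: all the operators involved are multiples
of powers of T, so that the sandwiches collapse to powers of a + b. *)
Lemma bop_expDZ a b T :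
  bop_exp (a *: T) * bop_exp (b *: T) = bop_exp ((a + b) *: T).
Proof.
have := @exp_sandwich R H (a *: T) (b *: T) 1; rewrite mulr1 => /cvg_lim <- //.
rewrite /bop_exp; congr (limn (series _)); apply/funext => h; congr (_ *: _).
rewrite scaleX addrC exprDn /sandwich scaler_suml; apply: eq_bigr => j _.
have jh : (j <= h)%N by rewrite -ltnS.
rewrite !scaleX mulr1 scaleMl scaleMr -exprD subnKC// !scalerA.
by congr (_ *: _); rewrite mulr_natl (mulrC (a ^+ _)).
Qed.

Lemma bop_expX c T k : (0 < k)%N ->
  bop_exp (c *: T) ^+ k = bop_exp ((c * k%:R) *: T).
Proof.
case: k => // k _; elim: k => [|k IH]; first by rewrite expr1 mulr1.
by rewrite exprSr IH bop_expDZ -[k.+2%:R]natr1 mulrDr mulr1.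
Qed.

Lemma adj_exp T : adj (bop_exp T) = bop_exp (adj T).
Proof.
apply: adj_lim (@bop_exp_cvg R H T) (@bop_exp_cvg R H (adj T)) => n x y.
rewrite dot_adj; congr (dot x (_ y)); rewrite /series /=.
rewrite adj_sum; congr (bop_val _); apply: eq_bigr => k _.
by rewrite adjZ adjX fmorphV rmorph_nat.
Qed.

Lemma exp_sandwichZ c X Y B :
  series (fun h => (c ^+ h / h`!%:R) *: sandwich X Y B h) @ \oo -->
  bop_exp (c *: X) * B * bop_exp (c *: Y).
Proof.
under eq_fun do rewrite mulrC -scalerA -sandwichZ.
exact: exp_sandwich.
Qed.

Lemma exp_sandwich_truncated c X Y B n : sandwich X Y B n = 0 ->
  bop_exp (c *: X) * B * bop_exp (c *: Y) =
  \sum_(h < n) (c ^+ h / h`!%:R) *: sandwich X Y B h.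
Proof.
move=> Wn; have /cvg_lim <- // := @exp_sandwichZ c X Y B; apply: cvg_lim => //.
apply: cvg_near_cst; exists n => // N /= nN; rewrite /series /=.
rewrite (big_cat_nat (leq0n n) nN)/= [X in _ + X]big_nat_cond.
rewrite [X in _ + X]big1 ?addr0 ?big_mkord//.
by move=> h /andP[/andP[nh _] _]; rewrite (sandwich_eq0 Wn nh) scaler0.
Qed.

(** Comparison of orders in s as s tends to 0 along the ray through w. *)
Lemma sandwich_eq0_of_truncated w X Y B n : `|w| = 1 ->
  (forall s : R, bop_exp ((w * s%:C) *: X) * B * bop_exp ((w * s%:C) *: Y) =
     \sum_(h < n) ((w * s%:C) ^+ h / h`!%:R) *: sandwich X Y B h) ->
  sandwich X Y B n = 0.
Proof.
move=> w1 trunc; set W := sandwich X Y B.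
pose z := rnorm X + rnorm Y.
have z0 : 0 <= z by rewrite addr_ge0 ?rnorm_ge0.
pose K := rnorm B * expR z.
have normc (s : R) h : 0 <= s ->
    complex.Re `|(w * s%:C) ^+ h / h`!%:R| = s ^+ h / h`!%:R.
  move=> s0; rewrite normrM normrX normrM w1 mul1r normfV normr_nat.
  rewrite ger0_norm ?ler0c// -rmorphXn /=.
  by rewrite -(rmorph_nat (real_complex R)) -fmorphV -rmorphM.
(* For s < 1 the terms beyond the n-th are bounded by s^(n+1) |B| z^h/h!, and
   these add up to at most s^(n+1) K.  The terms up to the n-th add up to a
   quantity that tends to 0, as the series converges to its truncation. *)
have small (s : R) : 0 < s < 1 -> rnorm (W n) / n`!%:R <= s * K.
  move=> /andP[s0 s1]; pose c := w * s%:C.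
  pose u h := (c ^+ h / h`!%:R) *: W h.
  have uL : series u @ \oo --> series u n.
    by rewrite /series /= big_mkord -trunc; exact: exp_sandwichZ.
  rewrite -(ler_pM2l (exprn_gt0 n s0)) -subr_le0.
  apply: (cvg0_bound_le0 _ (proj2 (cvg_rnorm _ _) uL)).
  exists n.+1 => // N /= nN; rewrite lerBlDr.
  have -> : s ^+ n * (rnorm (W n) / n`!%:R) = rnorm (u n).
    by rewrite rnormZ (normc _ _ (ltW s0)) mulrAC mulrA.
  have -> : u n = (series u N - series u n) - \sum_(n.+1 <= h < N) u h.
    by rewrite sub_series_geq 1?ltnW// (big_ltn nN) addrK.
  rewrite (le_trans (rnormD _ _))// rnormN rnormC lerD//.
  rewrite (le_trans (rnorm_sum _ _ _))//.
  apply: (@le_trans _ _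
      (\sum_(n.+1 <= h < N) s ^+ n.+1 * rnorm B * exp_coeff z h)).
    rewrite big_nat_cond [leRHS]big_nat_cond.
    apply: ler_sum => h /andP[/andP[nh _] _].
    rewrite rnormZ (normc _ _ (ltW s0)) /exp_coeff /=.
    have -> : s ^+ n.+1 * rnorm B * (z ^+ h / h`!%:R) =
      s ^+ n.+1 / h`!%:R * (z ^+ h * rnorm B) by ring.
    rewrite ler_pM ?rnorm_sandwich ?rnorm_ge0 ?divr_ge0 ?exprn_ge0 ?(ltW s0)//.
    by rewrite ler_wpM2r ?invr_ge0// ler_wiXn2l ?(ltW s0) ?(ltW s1).
  rewrite -mulr_sumr exprSr -!mulrA ler_wpM2l ?exprn_ge0 ?(ltW s0)//.
  rewrite ler_wpM2l ?(ltW s0)//.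
  rewrite /K ler_wpM2l ?rnorm_ge0//.
  apply: (@le_trans _ _ (series (exp_coeff z) N)).
    rewrite /series /= [leRHS](big_cat_nat (leq0n n.+1) nN)/= lerDr.
    by apply: sumr_ge0 => h _; rewrite divr_ge0 ?exprn_ge0.
  apply: nondecreasing_cvgn_le; last exact: is_cvg_series_exp_coeff.
  by apply: nondecreasing_series => h *; exact: exp_coeff_ge0.
apply: rnorm0_eq0; apply/eqP; rewrite eq_le rnorm_ge0 andbT.
have K0 : 0 <= K by rewrite mulr_ge0 ?rnorm_ge0 ?expR_ge0.
rewrite -(pmulr_lle0 _ (x := n`!%:R^-1)) ?invr_gt0 ?ltr0n ?fact_gt0//.
apply/ler_addgt0Pl => e e0; rewrite addr0.
have d0 : 0 < K + e + 1 by rewrite ltr_wpDl// addr_ge0// ltW.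
(* This value of s lies in ]0, 1[ and satisfies s K <= e. *)
have /small/le_trans->// : 0 < e / (K + e + 1) < 1.
  by rewrite divr_gt0//= ltr_pdivrMr// mul1r; lra.
by rewrite mulrAC ler_pdivrMr// ler_wpM2l ?ltW//; lra.
Qed.

(** Each part of the proposition is an instance, with w = -i or w = i. *)
Lemma sandwich_characterization w X Y B n : `|w| = 1 ->
  (sandwich X Y B n = 0 <->
   forall (k : nat) (s : R), (0 < k)%N ->
     bop_exp ((w * s%:C) *: X) ^+ k * B * bop_exp ((w * s%:C) *: Y) ^+ k =
     \sum_(h < n) ((w * s%:C * k%:R) ^+ h / h`!%:R) *: sandwich X Y B h).
Proof.
move=> w1; split=> [Wn k s k0|trunc].
  by rewrite !bop_expX// (exp_sandwich_truncated _ Wn).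
apply: (sandwich_eq0_of_truncated w1) => s.
by have := trunc 1%N s isT; rewrite !expr1 mulr1.
Qed.

Lemma OmegaE A m h T : Omega A m h T = sandwich (adj T) (- T) (calI A m T) h.
Proof.
apply: eq_bigr => j _; rewrite -[- T]scaleN1r scaleX scaleMr scalerA.
by rewrite mulrC.
Qed.

End Characterization.

Theorem proposition2p9 (R : realType) (H : hilbertType R)
    (H_separable : separable H) (A T : bop H) (A_pos : positive A) (m n : nat) :
  (isosymmetric A m n T <->
    forall (k : nat) (s : R), (0 < k)%N ->
      adj (bop_exp (('i * s%:C) *: T)) ^+ k * calI A m T *
        bop_exp (('i * s%:C) *: T) ^+ k =
      \sum_(h < n) ((- 'i * s%:C * k%:R) ^+ h / h`!%:R) *: Omega A m h T) /\
  (skew_isosymmetric A m n T <->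
    forall (k : nat) (s : R), (0 < k)%N ->
      bop_exp (('i * s%:C) *: adj T) ^+ k * calI A m T *
        bop_exp (('i * s%:C) *: T) ^+ k =
      \sum_(h < n) (('i * s%:C * k%:R) ^+ h / h`!%:R) *: Lambda A m h T).
Proof.
have i1 : `|'i : R[i]| = 1 by rewrite normc_def /= expr0n expr1n add0r sqrtr1.
(* Lambda is by definition the sandwich of calI A m T between adj T and T. *)
split; last exact: sandwich_characterization.
have Ni1 : `|- 'i : R[i]| = 1 by rewrite normrN.
have := sandwich_characterization (adj T) (- T) (calI A m T) n Ni1.
rewrite /isosymmetric OmegaE => ->.
have expE (s : R) : bop_exp ((- 'i * s%:C) *: - T) = bop_exp (('i * s%:C) *: T).
  by rewrite mulNr scaleNr scalerN opprK.
have adjE (s : R) :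
    bop_exp ((- 'i * s%:C) *: adj T) = adj (bop_exp (('i * s%:C) *: T)).
  by rewrite adj_exp (adjZ ('i * s%:C) T) conj_imaginary.
split=> trunc k s k0.
  by rewrite -adjE -expE trunc//; apply: eq_bigr => h _; rewrite OmegaE.
by rewrite adjE expE trunc//; apply: eq_bigr => h _; rewrite OmegaE.
Qed.
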